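(* There exists an element $F$ of the Fock space in two noncommuting variables which takes invertible values at every point of the row ball, but which has no logarithm on the row ball, i.e. there is no analytic free function $G$ on the row ball with $e^{G}=F$ there.
   Context: The row ball in two variables is the set of all pairs $(X,Y)$ of $n\times n$ complex matrices, $n\ge1$, with $XX^*+YY^*<1$ (that is, $1-XX^*-YY^*$ is positive definite). An element of the Fock space is a noncommutative power series $F=\sum_\alpha c_\alpha Z^\alpha$, with $\alpha$ ranging over all words in two noncommuting letters, $c_\alpha\in\mathbb{C}$ and $\sum_\alpha|c_\alpha|^2<\infty$; it is evaluated on matrix pairs in the row ball. A free function $G$ on the row ball maps pairs of $n\times n$ matrices to $n\times n$ matrices, satisfies $G(A\oplus B)=G(A)\oplus G(B)$ for points $A,B$ of the row ball, and $G(V^*AV)=V^*G(A)V$ for $V$ unitary; it is analytic if it is analytic at each matrix size. *)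

(* Defs.v *)
From HB Require Import structures.
From mathcomp Require Import all_boot all_order all_algebra.
From mathcomp Require Import complex.
From mathcomp Require Import all_classical all_reals all_analysis.

Set Implicit Arguments.
Unset Strict Implicit.
Unset Printing Implicit Defensive.

Import Order.TTheory GRing.Theory Num.Theory.
Import numFieldNormedType.Exports.

Local Open Scope classical_set_scope.
Local Open Scope sesquilinear_scope.
Local Open Scope ring_scope.

(* The topology and norm of the field [R[i]] itself, as the library does for its
   abstract numeric fields; matrices and pairs of matrices inherit from it. *)
HB.instance Definition _ (R : rcfType) := PseudoPointedMetric.copy R[i] R[i]^o.
HB.instance Definition _ (R : rcfType) := GRing.ComAlgebra.copy R[i] R[i]^o.
HB.instance Definition _ (R : rcfType) := Vector.copy R[i] R[i]^o.
HB.instance Definition _ (R : rcfType) := NormedModule.copy R[i] R[i]^o.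

(* All matrix sizes [n : nat] are allowed in the types; the size restriction
   [0 < n] appears wherever the size is quantified over. *)
Definition mxpair (R : realType) (n : nat) : Type :=
  ('M[R[i]]_n * 'M[R[i]]_n)%type.

(* In the partial order of [R[i]], [0 < z] says that [z] is real and positive. *)
Definition posdef (R : realType) (n : nat) (A : 'M[R[i]]_n) : Prop :=
  A ^t* = A /\ forall v : 'cV[R[i]]_n, v != 0 -> 0 < (v ^t* *m A *m v) 0 0.

Definition row_ball (R : realType) (n : nat) : set (mxpair R n) :=
  [set p | posdef (1%:M - p.1 *m p.1 ^t* - p.2 *m p.2 ^t*)].

(* A noncommutative power series is its family of coefficients, indexed by the
   words in two letters: [false] stands for the first variable and [true] for
   the second. *)
Definition ncseries (R : realType) : Type := seq bool -> R[i].

Definition in_fock (R : realType) (c : ncseries R) : Prop :=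
  (\esum_(w in [set: seq bool]) ((Normc.normc (c w)) ^+ 2)%:E < +oo)%E.

Definition mxword (R : realType) (n : nat) (p : mxpair R n) (w : seq bool) :
  'M[R[i]]_n := \prod_(b <- w) (if b then p.2 else p.1).

(* The series is summed by homogeneous components. On the row ball the family
   [c w *: mxword p w] of an element of the Fock space is absolutely summable
   (Cauchy-Schwarz), so the order of summation is immaterial there and the limit
   is a genuine one. *)
Definition nceval (R : realType) (c : ncseries R) (n : nat) (p : mxpair R n) :
  'M[R[i]]_n :=
  limn (series (fun k : nat => \sum_(w : k.-tuple bool) c w *: mxword p w)).

Definition expmx (R : realType) (n : nat) (A : 'M[R[i]]_n) : 'M[R[i]]_n :=
  limn (series (fun k : nat => (k`!%:R)^-1 *: A ^+ k)).

Definition dsummx (R : realType) (n m : nat) (A : 'M[R[i]]_n) (B : 'M[R[i]]_m) :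
  'M[R[i]]_(n + m) := block_mx A 0 0 B.

(* Only the values of a graded function on the row ball matter below. *)
Definition gradedfun (R : realType) : Type :=
  forall n : nat, mxpair R n -> 'M[R[i]]_n.

Definition free_function (R : realType) (G : gradedfun R) : Prop :=
  (forall (n m : nat) (p : mxpair R n) (q : mxpair R m),
     (0 < n)%N -> (0 < m)%N -> row_ball p -> row_ball q ->
     G (n + m)%N (dsummx p.1 q.1, dsummx p.2 q.2) = dsummx (G n p) (G m q)) /\
  (forall (n : nat) (p : mxpair R n) (V : 'M[R[i]]_n),
     (0 < n)%N -> row_ball p -> V \is unitarymx ->
     G n (V ^t* *m p.1 *m V, V ^t* *m p.2 *m V) = V ^t* *m G n p *m V).

(* Analyticity in the 2n^2 complex matrix entries, as complex (i.e. over the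
   field [R[i]]) Frechet differentiability at every point of the row ball, which
   is open. *)
Definition analytic_on_row_ball (R : realType) (G : gradedfun R) : Prop :=
  forall n : nat, (0 < n)%N -> forall p : 'M[R[i]]_n * 'M[R[i]]_n,
    row_ball p ->
    differentiable (G n : 'M[R[i]]_n * 'M[R[i]]_n -> 'M[R[i]]_n) p.

Definition has_log (R : realType) (c : ncseries R) : Prop :=
  exists G : gradedfun R,
    free_function G /\ analytic_on_row_ball G /\
    forall (n : nat) (p : mxpair R n),
      (0 < n)%N -> row_ball p -> expmx (G n p) = nceval c p.

(* Main.v *)
(* The witness is the polynomial F = (1 + X)^4 (1 + Y); both factors are
   invertible on the row ball because -1 is not an eigenvalue of a strict
   contraction. Suppose e^G = F and let g(a) be the value of G at the scalar
   point (a, 0).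

   For x = (-1 + i)/2 and y = (-1 - i)/2 one has (1 + x)^4 = (1 + y)^4 = -1/4,
   so that at the 2 x 2 point (diag(x, y), t E_12) the value of F is
   -1/4 (1 + t E_12). Since G commutes with e^G, for t != 0 it commutes with
   E_12 and so its two diagonal entries agree; letting t tend to 0, where G is
   the direct sum of g(x) and g(y), gives g(x) = g(y).

   On the other hand e^(g(a)/4) is a continuous fourth root of (1 + a)^4 on the
   segment from y to x, hence a constant multiple of 1 + a; then g(x) = g(y)
   would force x = y. *)

Require Import Defs.
From HB Require Import structures.
From mathcomp Require Import all_boot all_order all_algebra.
From mathcomp Require Import complex.
From mathcomp Require Import all_classical all_reals all_analysis.
From mathcomp Require Import ring lra.

Set Implicit Arguments.
Unset Strict Implicit.
Unset Printing Implicit Defensive.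

Import Order.TTheory GRing.Theory Num.Theory.
Import numFieldNormedType.Exports.

Local Open Scope classical_set_scope.
Local Open Scope sesquilinear_scope.
Local Open Scope ring_scope.
Local Open Scope complex_scope.

(** * The witness polynomial *)

(* The coefficients of (1 + X)^4 (1 + Y): only the words X^k and X^k Y occur,
   and the empty word is not counted twice since [rcons] is never empty. *)
Definition quartic_coef (R : realType) : ncseries R := fun w =>
  ((w == nseq (size w) false) * 'C(4, size w) +
   (w == rcons (nseq (size w).-1 false) true) * 'C(4, (size w).-1))%N%:R.

Lemma mxword_nseq (R : realType) (n k : nat) (p : mxpair R n) :
  mxword p (nseq k false) = p.1 ^+ k.
Proof. by rewrite /mxword big_nseq /= -Monoid.iteropE. Qed.

Lemma mxword_rcons (R : realType) (n : nat) (p : mxpair R n) w b :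
  mxword p (rcons w b) = mxword p w *m (if b then p.2 else p.1).
Proof. by rewrite /mxword -cats1 big_cat big_seq1. Qed.

(** Both summands of [quartic_coef] are the indicator of one word times a multiplicity, which is the
    shape summed here. *)
Lemma sum_tuple_pick (V : nmodType) (k : nat) (t : k.-tuple bool) m
    (F : seq bool -> V) :
  \sum_(w : k.-tuple bool) F w *+ ((tval w == tval t) * m)%N = F t *+ m.
Proof.
rewrite (bigD1 t) //= eqxx mul1n big1 ?addr0// => w wt.
by rewrite val_eqE (negPf wt).
Qed.

Lemma quartic_coef_homog (R : realType) (n k : nat) (p : mxpair R n) :
  \sum_(w : k.-tuple bool) quartic_coef R w *: mxword p w =
  p.1 ^+ k *+ 'C(4, k) +
  (if k is j.+1 then p.1 ^+ j *+ 'C(4, j) else 0) *m p.2.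
Proof.
under eq_bigr => w _ do
  rewrite /quartic_coef size_tuple scaler_nat mulrnDr.
rewrite big_split /=; congr (_ + _).
  by rewrite (sum_tuple_pick [tuple of nseq k false]) mxword_nseq.
case: k => [|k].
  by rewrite mul0mx big1// => w _; rewrite tuple0.
rewrite (sum_tuple_pick [tuple of rcons (nseq k false) true]) mxword_rcons.
by rewrite mxword_nseq -[RHS]/(mulmxr p.2 _) raddfMn.
Qed.

(** Binomial coefficients beyond index 4 vanish; the free [m] serves two truncations of different
    length. *)
Lemma sum_binomial4 (S : pzRingType) (x : S) (m : nat) :
  \sum_(0 <= k < 5 + m) x ^+ k *+ 'C(4, k) = (x + 1) ^+ 4.
Proof.
rewrite exprD1n (@big_cat_nat _ _ _ 5) ?leq_addr//= big_mkord.
rewrite [X in _ + X]big_nat_cond [X in _ + X]big1 ?addr0// => k.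
by rewrite andbT => /andP[k5 _]; rewrite bin_small.
Qed.

Lemma nceval_quartic (R : realType) (n : nat) (p : mxpair R n) :
  nceval (quartic_coef R) p = (p.1 + 1%:M) ^+ 4 *m (1%:M + p.2).
Proof.
apply: lim_near_cst; first exact: norm_hausdorff.
(* The polynomial has degree 5, so the partial sums are constant from six terms on. *)
exists 6%N => // N /= N6; rewrite /series /=.
under eq_bigr => k _ do rewrite quartic_coef_homog.
rewrite big_split /= -mulmx_suml -(subnKC N6).
rewrite (sum_binomial4 p.1 (1 + (N - 6))).
(* The factor of [Y] has no term at index 0; dropping it shifts the index and leaves [5 + (N - 6)]
   powers of [X]. *)
rewrite addSn big_nat_recl// add0r (sum_binomial4 p.1 (N - 6)).
by rewrite mulmxDr mulmx1.
Qed.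

(** The support lies in the ten words listed in [s], so the sum of squares is a finite sum. *)
Lemma in_fock_quartic (R : realType) : in_fock (quartic_coef R).
Proof.
pose s := [seq nseq k false | k <- iota 0 5] ++
          [seq rcons (nseq k false) true | k <- iota 0 5].
have ge0 w : (0 <= (Normc.normc (quartic_coef R w) ^+ 2)%:E)%E.
  by rewrite lee_fin sqr_ge0.
have sP w : w \notin s -> quartic_coef R w = 0.
  move=> ws; rewrite /quartic_coef.
  have -> : ((w == nseq (size w) false) * 'C(4, size w))%N = 0%N.
    case: eqP => //= we; have [w5|w5] := ltnP (size w) 5;
      last by rewrite bin_small.
    case/negP: ws; rewrite mem_cat; apply/orP; left.
    by apply/mapP; exists (size w) => //; rewrite mem_iota.
  suff -> : ((w == rcons (nseq (size w).-1 false) true) *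
            'C(4, (size w).-1))%N = 0%N by [].
  case: eqP => //= we; have [w5|w5] := ltnP (size w).-1 5;
    last by rewrite bin_small.
  case/negP: ws; rewrite mem_cat; apply/orP; right.
  by apply/mapP; exists (size w).-1 => //; rewrite mem_iota.
rewrite /in_fock.
rewrite (_ : (\esum_(w in _) _)%E =
   (\esum_(w in [set` s]) (Normc.normc (quartic_coef R w) ^+ 2)%:E)%E);
  last first.
  rewrite [RHS]esum_mkcond; apply: eq_esum => w _.
  case: ifPn => //; rewrite notin_setE /= => /negP /sP ->.
  by rewrite Normc.normc0 expr0n.
rewrite esum_fset//; last exact: finite_seq.
by rewrite fsumEFin ?ltry//; exact: finite_seq.
Qed.

(** Testing the form on the adjoint of [u] gives [|u|^2 - |uX|^2 - |uY|^2]; row vectors fit because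
    each variable stands to the left of its adjoint. *)
Lemma posdef_row (R : realType) (n : nat) (p : mxpair R n) (u : 'rV[R[i]]_n) :
  row_ball p -> u != 0 ->
  0 < (u *m u ^t* - (u *m p.1) *m (u *m p.1) ^t*
     - (u *m p.2) *m (u *m p.2) ^t*) 0 0.
Proof.
move=> [_ pd] u0.
have -> : u *m u ^t* - (u *m p.1) *m (u *m p.1) ^t*
      - (u *m p.2) *m (u *m p.2) ^t*
  = (u ^t*) ^t* *m (1%:M - p.1 *m p.1 ^t* - p.2 *m p.2 ^t*) *m u ^t*.
  rewrite trmxCK !mulmxBr !mulmxBl mulmx1 !trmx_mul !map_mxM.
  by rewrite !mulmxA.
apply: pd; apply: contra_neq u0 => u0.
by rewrite -[u]trmxCK u0 trmx0 map_mx0.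
Qed.

(** * The row ball *)

Lemma row_mul_adj_ge0 (R : realType) (n : nat) (u : 'rV[R[i]]_n) :
  0 <= (u *m u ^t*) 0 0.
Proof. by rewrite mxE sumr_ge0// => j _; rewrite !mxE mul_conjC_ge0. Qed.

Lemma unitmx_ker (F : fieldType) (n : nat) (A : 'M[F]_n) :
  (forall u : 'rV_n, u *m A = 0 -> u = 0) -> A \in unitmx.
Proof.
move=> Au; rewrite -row_free_unit -kermx_eq0; apply/eqP/row_matrixP => i.
by rewrite row0; apply: Au; rewrite -row_mul mulmx_ker row0.
Qed.

(** If [uX = -u] with [u != 0], then [|uX| = |u|] and [posdef_row] would make [-|uY|^2] positive;
    likewise with [X] and [Y] exchanged. *)
Lemma row_ball_add1_unit (R : realType) (n : nat) (p : mxpair R n) :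
  row_ball p -> (p.1 + 1%:M \in unitmx) /\ (1%:M + p.2 \in unitmx).
Proof.
move=> rp.
have opp (q : 'M[R[i]]_n) (u : 'rV[R[i]]_n) : u + u *m q = 0 ->
    (u *m q) *m (u *m q) ^t* = u *m u ^t*.
  move=> /eqP; rewrite addrC addr_eq0 => /eqP ->.
  by rewrite linearN /= map_mxN mulNmx mulmxN opprK.
split; apply: unitmx_ker => u; rewrite mulmxDr mulmx1.
  rewrite addrC => /opp uE; apply/eqP/negPn/negP => u0.
  have := posdef_row rp u0; rewrite uE subrr sub0r mxE oppr_gt0 => /lt_geF.
  by rewrite row_mul_adj_ge0.
move=> /opp uE; apply/eqP/negPn/negP => u0.
have := posdef_row rp u0; rewrite uE addrAC subrr sub0r mxE oppr_gt0 => /lt_geF.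
by rewrite row_mul_adj_ge0.
Qed.

Lemma posdef_scalar (R : realType) (c : R[i]) :
  0 < c -> posdef (c%:M : 'M[R[i]]_1).
Proof.
move=> c0; split.
  by rewrite tr_scalar_mx map_scalar_mx /= geC0_conj// ltW.
move=> v v0; rewrite mul_mx_scalar -scalemxAl mxE mulr_gt0// mxE big_ord1 !mxE.
rewrite mulrC mul_conjC_gt0; apply: contra_neq v0 => v0.
by apply/matrixP => i j; rewrite !ord1 v0 mxE.
Qed.

Lemma posdef_dsummx (R : realType) (n m : nat) (A : 'M[R[i]]_n)
    (B : 'M[R[i]]_m) : posdef A -> posdef B -> posdef (dsummx A B).
Proof.
move=> [Ah Ap] [Bh Bp]; split.
  by rewrite /dsummx tr_block_mx map_block_mx !trmx0 !map_mx0 Ah Bh.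
move=> v; rewrite -[v]vsubmxK; set v1 := usubmx v; set v2 := dsubmx v => v0.
rewrite tr_col_mx map_row_mx mul_row_block !mulmx0 addr0 add0r mul_row_col mxE.
have ge0 k (C : 'M[R[i]]_k) (w : 'cV[R[i]]_k) :
    (forall z : 'cV[R[i]]_k, z != 0 -> 0 < ((z ^t*) *m C *m z) 0 0) ->
    0 <= (w ^t* *m C *m w) 0 0.
  move=> Cp; have [->|/Cp/ltW//] := eqVneq w 0.
  by rewrite mulmx0 mxE.
(* One half of the vector is nonzero and contributes strictly; the other contributes at least 0. *)
have [v10|v10] := eqVneq v1 0; last by rewrite ltr_wpDr ?Ap ?ge0.
rewrite ltr_wpDl ?ge0// Bp//; apply: contra_neq v0 => v20.
by rewrite v10 v20 col_mx0.
Qed.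

Lemma row_ball_scalar (R : realType) (a : R[i]) :
  `|a| < 1 -> row_ball (a%:M : 'M[R[i]]_1, 0 : 'M[R[i]]_1).
Proof.
move=> a1; rewrite /row_ball /= mul0mx subr0 tr_scalar_mx map_scalar_mx /=.
rewrite -scalar_mxM -raddfB /=; apply: posdef_scalar.
by rewrite subr_gt0 -normCK expr_lt1// normr_ge0.
Qed.

(** The size [1 + 1] and the block form match [dsummx] of two scalar points. *)
Definition corner2 (R : realType) (t : R[i]) : 'M[R[i]]_(1 + 1) :=
  block_mx 0 t%:M 0 0.

(** [E_12] times its adjoint is [E_11], so the matrix to be tested is diagonal with entries
    [1 - |a|^2 - |t|^2] and [1 - |b|^2]. *)
Lemma row_ball_corner2 (R : realType) (a b t : R[i]) :
  `|a| ^+ 2 + `|t| ^+ 2 < 1 -> `|b| < 1 ->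
  row_ball (dsummx (a%:M : 'M[R[i]]_1) (b%:M : 'M[R[i]]_1), corner2 t).
Proof.
move=> at1 b1; rewrite /row_ball /= /dsummx /corner2.
rewrite !tr_block_mx !map_block_mx !mulmx_block !trmx0 !map_mx0.
rewrite !tr_scalar_mx !map_scalar_mx /=.
rewrite !mulmx0 !mul0mx !addr0 !add0r -!scalar_mxM.
rewrite (scalar_mx_block 1 1) opp_block_mx.
rewrite add_block_mx opp_block_mx add_block_mx !oppr0 !addr0 -!raddfB /=.
apply: posdef_dsummx; apply: posdef_scalar; rewrite -!normCK.
  by rewrite -addrA -opprD subr_gt0.
by rewrite subr_gt0 expr_lt1 ?normr_ge0.
Qed.

(** * The complex and matrix exponentials *)

Section ComplexLimits.
Variable R : realType.
Implicit Types (u : nat -> R[i]) (z w : R[i]).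

Lemma norm_real_complex (x : R) : `|x%:C| = `|x|%:C.
Proof. by rewrite normc_def /= expr0n addr0 sqrtr_sqr. Qed.

Lemma norm_complexi : `|'i| = 1 :> R[i].
Proof. by rewrite normc_def /= expr0n expr1n add0r sqrtr1. Qed.

Lemma normc_le_ReIm z : `|z| <= (`|complex.Re z| + `|complex.Im z|)%:C.
Proof.
rewrite {1}[z]complexE raddfD /= -!norm_real_complex.
rewrite (le_trans (ler_normD _ _))// lerD2l normrM.
by rewrite norm_complexi mul1r.
Qed.

Lemma normc_Im_le z : `|complex.Im z|%:C <= `|z|.
Proof.
(* The imaginary part of [z] is the real part of [-iz]. *)
have := normc_ge_Re (- ('i%C * z)); rewrite normrN normrM.
rewrite norm_complexi; case: z => a b /=.
by rewrite !(mul0r, mul1r, add0r, opprK).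
Qed.

(** Positivity in [R[i]] includes being real, so every complex epsilon reduces to a real one. *)
Lemma gt0_complex (e : R[i]) : 0 < e -> exists2 r : R, 0 < r & e = r%:C.
Proof.
case: e => a b; rewrite ltcE /= => /andP[/eqP b0 a0].
by exists a => //; rewrite b0.
Qed.

Lemma cvg_complex (T : Type) (F : set_system T) {FF : Filter F}
    (f : T -> R[i]) (a b : R) :
  complex.Re (f x) @[x --> F] --> a -> complex.Im (f x) @[x --> F] --> b ->
  f x @[x --> F] --> (a +i* b : R[i]).
Proof.
move=> /cvgrPdist_lt fa /cvgrPdist_lt fb; apply/cvgrPdist_lt => e.
move=> /gt0_complex[r r0 ->].
have r20 : 0 < r / 2 by rewrite divr_gt0.
near=> x; apply: le_lt_trans (normc_le_ReIm _) _; rewrite ltcR.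
have -> : r = r / 2 + r / 2 by rewrite -splitr.
rewrite ltrD//.
  have : `|a - complex.Re (f x)| < r / 2 by near: x; exact: fa.
  by case: (f x).
have : `|b - complex.Im (f x)| < r / 2 by near: x; exact: fb.
by case: (f x).
Unshelve. all: by end_near. Qed.

Lemma cvg_ReIm (T : Type) (F : set_system T) {FF : Filter F}
    (f : T -> R[i]) (z : R[i]) : f x @[x --> F] --> z ->
  complex.Re (f x) @[x --> F] --> complex.Re z /\
  complex.Im (f x) @[x --> F] --> complex.Im z.
Proof.
move=> /cvgrPdist_lt fz; split; apply/cvgrPdist_lt => e e0;
  have := fz e%:C; rewrite ltcR => /(_ e0); apply: filterS => x fx;
  rewrite -ltcR; apply: le_lt_trans fx.
  by have := normc_ge_Re (z - f x); case: (z) (f x) => [a b] [c d].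
by have := normc_Im_le (z - f x); case: (z) (f x) => [a b] [c d].
Qed.

Lemma Re_series u n :
  complex.Re (series u n) = series (fun k => complex.Re (u k)) n.
Proof.
rewrite /series /=.
by apply: (big_ind2 (fun z x => complex.Re z = x)) => //
  -[a b] x [c d] y /= <- <-.
Qed.

Lemma Im_series u n :
  complex.Im (series u n) = series (fun k => complex.Im (u k)) n.
Proof.
rewrite /series /=.
by apply: (big_ind2 (fun z x => complex.Im z = x)) => //
  -[a b] x [c d] y /= <- <-.
Qed.

Lemma dominated_cvg_series (v : R^nat) (a : R^nat) :
  (forall k, `|v k| <= a k) -> cvgn (series a) -> cvgn (series v).
Proof.
move=> va ca; apply: normed_cvg; apply: series_le_cvg ca => //= k.
exact: le_trans (normr_ge0 _) (va k).
Qed.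

Lemma dominated_cvg_complex_series u (a : R^nat) :
  (forall k, `|u k| <= (a k)%:C) -> cvgn (series a) -> cvgn (series u).
Proof.
move=> ua ca.
have /cvg_ex[x xP] : cvgn (series (fun k => complex.Re (u k))).
  apply: dominated_cvg_series ca => k; rewrite -lecR.
  exact: le_trans (normc_ge_Re _) (ua k).
have /cvg_ex[y yP] : cvgn (series (fun k => complex.Im (u k))).
  apply: dominated_cvg_series ca => k; rewrite -lecR.
  exact: le_trans (normc_Im_le _) (ua k).
apply/cvg_ex; exists (x +i* y); apply: cvg_complex.
  by under eq_fun do rewrite Re_series.
by under eq_fun do rewrite Im_series.
Qed.

Lemma cvg_mx (T : Type) (F : set_system T) {FF : Filter F} (m n : nat)
    (f : T -> 'M[R[i]]_(m, n)) (l : 'M[R[i]]_(m, n)) :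
  (forall i j, f x i j @[x --> F] --> l i j) -> f x @[x --> F] --> l.
Proof.
move=> fl; apply/cvg_ballP => e e0.
(* There are finitely many entries, so their neighbourhood conditions hold simultaneously. *)
have H : \forall x \near F, forall ij : 'I_m * 'I_n,
    ball (l ij.1 ij.2) e (f x ij.1 ij.2).
  apply: filter_forall => -[i j] /=.
  by move/cvg_ballP : (fl i j); apply.
near=> x; split => // i j.
by have := near H x; move=> /(_ _ (i, j)); apply.
Unshelve. all: by end_near. Qed.

Lemma limn_norm_le (V : normedModType R[i]) (u : nat -> V) (l : V) (b : R) :
  u @ \oo --> l -> (forall k, `|u k| <= b%:C) -> `|l| <= b%:C.
Proof.
move=> ul ub; have b0 : 0 <= b%:C := le_trans (normr_ge0 _) (ub 0%N).
(* The order of [R[i]] is partial, so an inequality can be negated only between real elements. *)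
rewrite real_leNgt ?normr_real ?ger0_real//; apply/negP => bl.
move/cvgrPdist_lt : ul => /(_ (`|l| - b%:C)).
rewrite subr_gt0 => /(_ bl) [N _ NP].
have := NP N (leqnn N); apply/negP; rewrite -real_leNgt ?rpredB ?ger0_real//.
by rewrite (le_trans _ (lerB_dist _ _))// lerB.
Qed.

End ComplexLimits.

(** * The scalar exponential: addition formula and continuity *)

Definition exp_sum (K : unitRingType) (z : K) (n : nat) : K :=
  \sum_(0 <= k < n) (k`!%:R)^-1 * z ^+ k.

(** By the binomial theorem the truncation at a sum runs over the triangle [i + j < n], to be
    compared with the square that a product of truncations gives. *)
Lemma exp_sumD (K : numFieldType) (z w : K) (n : nat) :
  exp_sum (z + w) n = \sum_(0 <= i < n) \sum_(0 <= j < n | (i + j < n)%N)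
    ((i`!%:R)^-1 * z ^+ i) * ((j`!%:R)^-1 * w ^+ j).
Proof.
pose T i j : K := ((i`!%:R)^-1 * z ^+ i) * ((j`!%:R)^-1 * w ^+ j).
(* The terms are first grouped by degree [k = i + j]; then the sums are exchanged and [j = k - i] is
   substituted. *)
transitivity (\sum_(0 <= k < n) \sum_(0 <= i < n | (i <= k)%N) T i (k - i)%N).
  apply: eq_big_nat => k /andP[_ kn].
  rewrite addrC exprDn mulr_sumr -(big_mkord xpredT
    (fun i => (k`!%:R)^-1 * ((w ^+ (k - i) * z ^+ i) *+ 'C(k, i)))).
  rewrite [RHS]big_mkcond /= (@big_cat_nat _ _ _ k.+1 0 n)//=.
  rewrite [X in _ = _ + X]big_nat_cond [X in _ = _ + X]big1 ?addr0; last first.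
    by move=> i; rewrite andbT => /andP[ki _]; rewrite leqNgt ki.
  apply: eq_big_nat => i /andP[_ ik]; rewrite ltnS in ik; rewrite ik /T.
  have /(congr1 (fun m => m%:R : K)) := bin_fact ik; rewrite !natrM => bE.
  have f0 m : (m`!%:R : K) != 0 by rewrite pnatr_eq0 -lt0n fact_gt0.
  rewrite -bE -[(_ * _) *+ _]mulr_natr !invfM.
  have := f0 i; have := f0 (k - i)%N.
  have : 'C(k, i)%:R != 0 :> K by rewrite pnatr_eq0 -lt0n bin_gt0.
  move: ('C(k, i)%:R : K) (i`!%:R : K) ((k - i)`!%:R : K)
    (w ^+ (k - i)) (z ^+ i) => c a b x y c0 b0 a0.
  by field; rewrite a0 b0 c0.
rewrite (exchange_big_dep_nat xpredT)//=; apply: eq_big_nat => i /andP[_ ni].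
rewrite -(big_nat_widenl _ _ _ xpredT)//= -{1}(add0n i) big_addn.
rewrite (big_nat_widen _ _ _ _ _ (leq_subr i n)).
by apply: eq_big => [j|j _]; rewrite ?ltn_subRL// addnK.
Qed.

(* The left-hand difference is a polynomial in z and w with nonnegative
   coefficients. The majorant tends to 0 by the real identity [expRD], which
   spares a separate proof of the Cauchy product formula. *)
Lemma norm_exp_sumD_le (K : numFieldType) (z w : K) (n : nat) :
  `|exp_sum (z + w) (n + n) - exp_sum z n * exp_sum w n| <=
  exp_sum (`|z| + `|w|) (n + n) - exp_sum `|z| n * exp_sum `|w| n.
Proof.
(* [chi] marks the triangle minus the square; the square lies inside the triangle, so the truncated
   subtraction is harmless. *)
pose chi i j : nat := ((i + j < n + n) - ((i < n) && (j < n)))%N.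
have E (x y : K) : exp_sum (x + y) (n + n) - exp_sum x n * exp_sum y n =
    \sum_(0 <= i < n + n) \sum_(0 <= j < n + n)
      ((i`!%:R)^-1 * x ^+ i) * ((j`!%:R)^-1 * y ^+ j) *+ chi i j.
  rewrite exp_sumD /exp_sum mulr_suml.
  rewrite (big_nat_widen _ _ _ _ _ (leq_addr n n)) [X in _ - X]big_mkcond /=.
  rewrite -sumrB; apply: eq_bigr => i _.
  rewrite (big_mkcond (fun j => i + j < n + n)%N) /=.
  rewrite (_ : (if _ then _ else _) = \sum_(0 <= j < n + n)
     if ((i < n) && (j < n))%N
     then ((i`!%:R)^-1 * x ^+ i) * ((j`!%:R)^-1 * y ^+ j) else 0); last first.
    case: ifP => /= _; last by rewrite big1.
    by rewrite mulr_sumr (big_nat_widen _ _ _ _ _ (leq_addr n n)) big_mkcond.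
  rewrite -sumrB; apply: eq_bigr => j _; rewrite /chi.
  have [/andP[ni nj]|_] := boolP ((i < n) && (j < n))%N; last first.
    by case: ifP; rewrite ?subr0.
  have -> : (i + j < n + n)%N by rewrite -addnS leq_add// ltnW.
  by rewrite subrr.
rewrite !E; apply: (le_trans (ler_norm_sum _ _ _)); apply: ler_sum => i _.
apply: (le_trans (ler_norm_sum _ _ _)); apply: ler_sum => j _.
by rewrite normrMn !normrM !normfV !normrX !normr_nat.
Qed.

Section ComplexExponential.
Variable R : realType.
Implicit Types (z w : R[i]) (x : R).

Lemma normc_nonneg z : 0 <= Normc.normc z.
Proof. by case: z => a b; exact: sqrtr_ge0. Qed.

(** Reads a majorant computed in [R[i]] as a real sequence, where [expR] is available. *)
Lemma exp_sum_real x n : exp_sum (x%:C) n = (exp_sum x n)%:C.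
Proof.
rewrite /exp_sum rmorph_sum; apply: eq_bigr => k _.
by rewrite rmorphM fmorphV rmorph_nat rmorphXn.
Qed.

Lemma exp_sum_expR x : exp_sum x @ \oo --> expR x.
Proof.
have := is_cvg_series_exp_coeff x; rewrite exp_coeffE => cv.
by rewrite /expR exp_coeffE; exact: cv.
Qed.

Definition expc z : R[i] := limn (exp_sum z).

Lemma exp_sum_expc z : exp_sum z @ \oo --> expc z.
Proof.
apply: (@dominated_cvg_complex_series _ (fun k => (k`!%:R)^-1 * z ^+ k)
  (exp_coeff (Normc.normc z))); last exact: is_cvg_series_exp_coeff.
move=> k; rewrite exp_coeffE normrM normfV normrX normr_nat.
by rewrite rmorphM fmorphV rmorph_nat rmorphXn.
Qed.

Lemma expc0 : expc 0 = 1.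
Proof.
apply: lim_near_cst => //; exists 1%N => // -[|n] //= _.
rewrite /exp_sum big_nat_recl// big1_seq ?addr0 => [|k _].
  by rewrite fact0 invr1 mul1r.
by rewrite expr0n /= mulr0.
Qed.

Lemma cvgn_double (T : topologicalType) (u : nat -> T) (l : T) :
  u @ \oo --> l -> u (n + n)%N @[n --> \oo] --> l.
Proof.
apply: cvg_comp => A [N _ NA]; exists N => // n /= Nn.
by apply: NA; rewrite /= (leq_trans Nn)// leq_addr.
Qed.

(** [d] tends to the difference of the two sides, and also to 0 because its real analogue [r]
    dominates it. *)
Lemma expcD z w : expc (z + w) = expc z * expc w.
Proof.
pose d n := exp_sum (z + w) (n + n) - exp_sum z n * exp_sum w n.
have dl : d @ \oo --> expc (z + w) - expc z * expc w.
  apply: cvgB; first exact: (cvgn_double (@exp_sum_expc (z + w))).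
  by apply: cvgM; exact: exp_sum_expc.
apply/eqP; rewrite -subr_eq0; apply/eqP.
apply: (cvg_unique (@norm_hausdorff _ R[i]^o) dl).
pose a := Normc.normc z; pose b := Normc.normc w.
pose r n := exp_sum (a + b) (n + n) - exp_sum a n * exp_sum b n.
have r0 : r @ \oo --> (0 : R).
  rewrite -(subrr (expR (a + b))) [X in _ - X]expRD; apply: cvgB.
    exact: (cvgn_double (@exp_sum_expR (a + b))).
  by apply: cvgM; exact: exp_sum_expR.
have dr n : `|d n| <= (r n)%:C.
  apply: le_trans (norm_exp_sumD_le _ _ _) _.
  rewrite /r rmorphB rmorphM /= -!exp_sum_real rmorphD //.
apply/cvgrPdist_lt => e /gt0_complex[s s0 ->].
move/cvgrPdist_lt : r0 => /(_ _ s0); apply: filterS => n.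
rewrite !sub0r !normrN => rs; apply: le_lt_trans (dr n) _.
by rewrite ltcR (le_lt_trans (ler_norm _)).
Qed.

Lemma expc_mulrn z n : expc (z *+ n) = expc z ^+ n.
Proof.
elim: n => [|n IHn]; first by rewrite mulr0n expc0 expr0.
by rewrite mulrS expcD IHn exprS.
Qed.

(** Without the constant term, the series is bounded termwise by the real one at [|z|], whose
    partial sums increase to [expR]. *)
Lemma norm_expc_sub1 z : `|expc z - 1| <= (expR (Normc.normc z) - 1)%:C.
Proof.
have cv : (exp_sum z n.+1 - 1) @[n --> \oo] --> expc z - 1.
  have := @exp_sum_expc z; rewrite -(cvg_shiftS (exp_sum z)) => zS.
  exact: (cvgB zS (cvg_cst (1 : R[i]))).
apply: limn_norm_le cv _ => n.
set r := Normc.normc z.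
have -> : exp_sum z n.+1 - 1 = \sum_(0 <= k < n) (k.+1`!%:R)^-1 * z ^+ k.+1.
  by rewrite /exp_sum big_nat_recl// fact0 invr1 mul1r expr0 addrAC subrr add0r.
apply: le_trans (ler_norm_sum _ _ _) _.
have -> : \sum_(0 <= k < n) `|(k.+1`!%:R)^-1 * z ^+ k.+1| =
    (exp_sum r n.+1 - 1)%:C.
  rewrite /exp_sum big_nat_recl// fact0 invr1 mul1r expr0 addrAC subrr add0r.
  rewrite rmorph_sum; apply: eq_bigr => k _.
  by rewrite rmorphM fmorphV rmorph_nat rmorphXn normrM normfV normrX normr_nat.
rewrite lecR lerB//.
have r0 : 0 <= r := normc_nonneg _.
have nd : nondecreasing_seq (exp_sum r).
  apply/nondecreasing_seqP => k; rewrite /exp_sum big_nat_recr//= lerDl.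
  by rewrite mulr_ge0 ?invr_ge0 ?exprn_ge0.
have := nondecreasing_cvgn_le nd (cvgP _ (@exp_sum_expR r)) n.+1.
by rewrite (cvg_lim _ (@exp_sum_expR r)).
Qed.

(** The addition formula moves the question to the origin, where [norm_expc_sub1] and the continuity
    of [expR] at 0 settle it. *)
Lemma expc_continuous : continuous expc.
Proof.
move=> z; apply/(@cvgrPdist_lt _ R[i]^o _ _ (nbhs_filter (z : R[i]^o))).
move=> _ /gt0_complex[e e0 ->].
(* The added 1 makes [M] positive, so that [e / M] is an admissible tolerance. *)
pose M := Normc.normc (expc z) + 1.
have M0 : 0 < M by rewrite ltr_wpDl// normc_nonneg.
have /cvgrPdist_lt/(_ (e / M)) := @continuous_expR R 0.
rewrite divr_gt0// => /(_ isT)/nbhs_ballP[d /= d0 dP].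
apply/nbhs_ballP; exists d%:C; first by rewrite /= ltcR.
move=> w /= zw.
have -> : expc z - expc w = - (expc z * (expc (w - z) - 1)).
  by rewrite mulrBr -expcD mulr1 [z + _]addrC subrK opprB.
rewrite normrN normrM.
set r := Normc.normc (w - z).
have r0 : 0 <= r := normc_nonneg _.
have {}zw : `|z - w| < d%:C := zw.
have rd : r < d by rewrite distrC in zw; rewrite -ltcR; exact: zw.
have re : `|expR 0 - expR r| < e / M.
  by apply: dP; rewrite /ball /= sub0r normrN ger0_norm.
have r1 : 1 <= expR r by rewrite (le_trans _ (expR_ge1Dx r))// lerDl.
rewrite expR0 distrC ger0_norm ?subr_ge0// ltr_pdivlMr// in re.
apply: (@le_lt_trans _ _ ((expR r - 1) * M)%:C); last by rewrite ltcR.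
rewrite mulrC rmorphM ler_pM ?normr_ge0 ?norm_expc_sub1// /M rmorphD lerDl.
by rewrite ler01.
Qed.

End ComplexExponential.

(** * The matrix exponential, entry by entry *)

Lemma cvg_sum_complex (R : realType) (T : Type) (F : set_system T)
    {FF : Filter F} (I : finType) (f : I -> T -> R[i]) (l : I -> R[i]) :
  (forall i, f i x @[x --> F] --> l i) ->
  \sum_i f i x @[x --> F] --> \sum_i l i.
Proof.
move=> fl; apply: (@cvg_big R[i]^o I +%R 0 xpredT _ T F) => [x|i _].
  by apply: (@cvgD R[i] R[i]^o _ _ _ fst snd); [exact: cvg_fst|exact: cvg_snd].
exact: fl.
Qed.

Lemma cvg_mx_entry (R : realType) (T : Type) (F : set_system T)
    {FF : Filter F} (m n : nat) (f : T -> 'M[R[i]]_(m, n))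
    (A : 'M[R[i]]_(m, n)) i j :
  f x @[x --> F] --> A -> f x i j @[x --> F] --> A i j.
Proof.
by move=> fA; apply: (cvg_comp f (fun M => M i j) fA); exact: coord_continuous.
Qed.

Section MatrixExponential.
Variables (R : realType) (n : nat).
Implicit Types A B : 'M[R[i]]_n.

(** Induction on [k]: the sum of all entry norms bounds each row sum, hence each further factor
    [A]. *)
Lemma norm_mxX_entry_le A k i j :
  `|(A ^+ k) i j| <= (\sum_i \sum_j `|A i j|) ^+ k.
Proof.
elim: k i j => [|k IHk] i j.
  by rewrite !expr0 mxE; case: eqP; rewrite ?normr1 ?normr0 ?ler01.
rewrite exprS exprS mxE (le_trans (ler_norm_sum _ _ _))//.
apply: (@le_trans _ _ ((\sum_l `|A i l|) * (\sum_a \sum_b `|A a b|) ^+ k)).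
  by rewrite mulr_suml; apply: ler_sum => l _; rewrite normrM ler_wpM2l.
rewrite ler_wpM2r ?exprn_ge0 ?sumr_ge0// => [a _|]; first exact: sumr_ge0.
by rewrite [leRHS](bigD1 i)//= lerDl sumr_ge0// => a _; exact: sumr_ge0.
Qed.

(** Makes the [limn] in [expmx] a genuine limit: each entry is dominated by the real exponential
    series at the sum [N] of the entry norms. *)
Lemma expmx_cvg A :
  series (fun k => (k`!%:R)^-1 *: A ^+ k) @ \oo --> expmx A.
Proof.
pose N := \sum_i \sum_j Normc.normc (A i j).
have NE : N%:C = \sum_i \sum_j `|A i j|.
  by rewrite rmorph_sum; apply: eq_bigr => i _; rewrite rmorph_sum.
have cv i j : cvgn (series (fun k => ((k`!%:R)^-1 *: A ^+ k) i j)).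
  apply: (@dominated_cvg_complex_series _ _ (exp_coeff N)); last first.
    exact: is_cvg_series_exp_coeff.
  move=> k; rewrite exp_coeffE mxE normrM normfV normr_nat.
  rewrite rmorphM fmorphV rmorph_nat rmorphXn /= NE.
  by rewrite ler_wpM2l ?invr_ge0// norm_mxX_entry_le.
suff : cvgn (series (fun k => (k`!%:R)^-1 *: A ^+ k)) by [].
apply/cvg_ex; exists (\matrix_(i, j)
  limn (series (fun k => ((k`!%:R)^-1 *: A ^+ k) i j))).
apply: cvg_mx => i j; rewrite mxE.
rewrite (_ : (fun m => _) = series (fun k => ((k`!%:R)^-1 *: A ^+ k) i j)).
  exact: cv.
by apply/funext => m; rewrite /series /= summxE.
Qed.

Lemma cvg_mulmx_l (u : nat -> 'M[R[i]]_n) A B :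
  u @ \oo --> A -> (B *m u k) @[k --> \oo] --> B *m A.
Proof.
move=> uA; apply: cvg_mx => i j; under eq_fun do rewrite mxE.
rewrite mxE; apply: cvg_sum_complex => l.
apply: cvgMl_tmp; exact: cvg_mx_entry.
Qed.

Lemma cvg_mulmx_r (u : nat -> 'M[R[i]]_n) A B :
  u @ \oo --> A -> (u k *m B) @[k --> \oo] --> A *m B.
Proof.
move=> uA; apply: cvg_mx => i j; under eq_fun do rewrite mxE.
rewrite mxE; apply: cvg_sum_complex => l.
apply: cvgMr_tmp; exact: cvg_mx_entry.
Qed.

(** [A] commutes with the partial sums, and multiplication by [A] on either side passes to the
    limit. *)
Lemma expmx_comm A : A *m expmx A = expmx A *m A.
Proof.
have l := cvg_mulmx_l (B := A) (@expmx_cvg A).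
have r := cvg_mulmx_r (B := A) (@expmx_cvg A).
apply: (cvg_unique (@norm_hausdorff _ 'M[R[i]]_n) l).
rewrite (_ : (fun k => _) =
  (fun k => series (fun k => (k`!%:R)^-1 *: A ^+ k) k *m A))//.
apply/funext => m; rewrite /series /= mulmx_sumr mulmx_suml.
apply: eq_bigr => k _; rewrite -scalemxAr -scalemxAl.
by rewrite -[A *m _]/(A * A ^+ k) -[_ *m A]/(A ^+ k * A) -exprS -exprSr.
Qed.

End MatrixExponential.

Lemma expmx_scalar (R : realType) (A : 'M[R[i]]_1) :
  expmx A 0 0 = expc (A 0 0).
Proof.
have h : (series (fun k => (k`!%:R)^-1 *: A ^+ k) m) 0 0 @[m --> \oo] -->
    expmx A 0 0.
  exact: cvg_mx_entry (@expmx_cvg _ _ A).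
apply: (cvg_unique (@norm_hausdorff _ R[i]^o) h).
rewrite (_ : (fun m => _) = exp_sum (A 0 0)); first exact: exp_sum_expc.
apply/funext => m; rewrite /series /= summxE; apply: eq_bigr => k _.
by rewrite mxE [A in LHS]mx11_scalar -rmorphXn /= mxE.
Qed.

(** * Nonexistence of a logarithm *)

Section NoLog.
Variables (R : realType) (G : gradedfun R).
Hypothesis Gfree : free_function G.
Hypothesis Gan : analytic_on_row_ball G.
Hypothesis Gexp : forall (n : nat) (p : mxpair R n),
  (0 < n)%N -> row_ball p -> expmx (G p) = nceval (quartic_coef R) p.

Let g (a : R[i]) : R[i] := G (a%:M : 'M[R[i]]_1, 0 : 'M[R[i]]_1) 0 0.

(** The upper right block of the commutation relation equates [t] times each diagonal block. *)
Lemma comm_corner2 (H : 'M[R[i]]_(1 + 1)) (t : R[i]) :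
  t != 0 -> H *m corner2 t = corner2 t *m H -> ulsubmx H = drsubmx H.
Proof.
move=> t0; rewrite -[H]submxK /corner2 !mulmx_block.
rewrite !mulmx0 !mul0mx !addr0 !add0r.
move/eq_block_mx => [_ + _ _]; rewrite mul_mx_scalar mul_scalar_mx submxK.
by move/(scalerI t0).
Qed.

Lemma unit_disc_add1_neq0 (a : R[i]) : `|a| < 1 -> a + 1 != 0.
Proof.
by move=> a1; apply: contraTneq a1 => /eqP; rewrite addr_eq0 => /eqP ->;
  rewrite normrN1 ltxx.
Qed.

(** Equal fourth powers make [(1 + X)^4] a scalar matrix, although [X] itself need not be scalar. *)
Lemma nceval_corner2 (a b t : R[i]) : (a + 1) ^+ 4 = (b + 1) ^+ 4 ->
  nceval (quartic_coef R)
    (dsummx (a%:M : 'M[R[i]]_1) (b%:M : 'M[R[i]]_1), corner2 t) =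
  (a + 1) ^+ 4 *: (1%:M + corner2 t).
Proof.
move=> ab; rewrite nceval_quartic /= /dsummx (scalar_mx_block 1 1).
rewrite add_block_mx !addr0 -!raddfD /=.
have X k : (block_mx (a + 1)%:M 0 0 (b + 1)%:M : 'M[R[i]]_(1 + 1)) ^+ k =
    block_mx ((a + 1) ^+ k)%:M 0 0 ((b + 1) ^+ k)%:M.
  elim: k => [|k IHk]; first by rewrite !expr0 -scalar_mx_block.
  rewrite !exprS IHk -[LHS]/(_ *m _) mulmx_block.
  by rewrite !mulmx0 !mul0mx !addr0 !add0r -!scalar_mxM.
by rewrite X -ab -scalar_mx_block mul_scalar_mx.
Qed.

Lemma log_eq_diag (a b : R[i]) : `|a| < 1 -> `|b| < 1 ->
  (a + 1) ^+ 4 = (b + 1) ^+ 4 -> g a = g b.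
Proof.
move=> a1 b1 ab; set D := dsummx (a%:M : 'M[R[i]]_1) (b%:M : 'M[R[i]]_1).
pose H (t : R[i]) : 'M[R[i]]_(1 + 1) := G (D, corner2 t).
have rb (t : R[i]) : `|t| ^+ 2 < 1 - `|a| ^+ 2 -> row_ball (D, corner2 t).
  by move=> ht; apply: row_ball_corner2 => //; rewrite addrC -ltrBrDr.
have a2 : 0 < 1 - `|a| ^+ 2 by rewrite subr_gt0 expr_lt1// normr_ge0.
have diagH (t : R[i]) : t != 0 -> `|t| ^+ 2 < 1 - `|a| ^+ 2 ->
    ulsubmx (H t) = drsubmx (H t).
  move=> t0 ht; apply: (comm_corner2 t0).
  have := expmx_comm (H t); rewrite Gexp//; last exact: rb.
  rewrite nceval_corner2// -scalemxAr -scalemxAl.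
  (* Cancelling the nonzero [(a + 1)^4] and then the identity term leaves commutation with
     [corner2 t]. *)
  move/(scalerI (expf_neq0 4 (unit_disc_add1_neq0 a1))).
  by rewrite mulmxDr mulmxDl mulmx1 mul1mx => /addrI.
have corner0 : corner2 0 = 0 :> 'M[R[i]]_(1 + 1).
  by rewrite /corner2 raddf0 block_mx0.
have H0 : H 0 = dsummx (G (a%:M : 'M[R[i]]_1, 0 : 'M[R[i]]_1))
                       (G (b%:M : 'M[R[i]]_1, 0 : 'M[R[i]]_1)).
  have [Gsum _] := Gfree; rewrite -(Gsum 1%N 1%N _ _ isT isT
    (row_ball_scalar a1) (row_ball_scalar b1)).
  by rewrite /H /= corner0 /dsummx block_mx0.
have cornerc : corner2 t @[t --> (0 : R[i])] --> corner2 0.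
  have cE t : corner2 t = t *: corner2 1 :> 'M[R[i]]_(1 + 1).
    by rewrite /corner2 scale_block_mx !scaler0 scale_scalar_mx mulr1.
  rewrite cE; under eq_fun do rewrite cE.
  by apply: (@cvgZr_tmp _ _ _ (nbhs (0 : R[i]^o)) _ id) => P PP; exact: PP.
(* The limit is over [t != 0], since commuting with [corner2 0 = 0] says nothing. *)
have Hc : H t @[t --> (0 : R[i])^'] --> H 0.
  apply: cvg_within_filter.
  have a20 : `|0 : R[i]| ^+ 2 < 1 - `|a| ^+ 2 by rewrite normr0 expr0n.
  have Gc := differentiable_continuous (Gan (isT : (0 < 1 + 1)%N) (rb 0 a20)).
  apply: (cvg_comp (fun t => (D, corner2 t)) (@G (1 + 1)%N) _ Gc).
  exact: (cvg_pair (cvg_cst D) cornerc).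
have dc : ulsubmx (H t) 0 0 - drsubmx (H t) 0 0 @[t --> (0 : R[i])^'] -->
    ulsubmx (H 0) 0 0 - drsubmx (H 0) 0 0.
  under eq_fun do rewrite !mxE; rewrite !mxE.
  by apply: cvgB; exact: cvg_mx_entry.
have d0 : ulsubmx (H t) 0 0 - drsubmx (H t) 0 0 @[t --> (0 : R[i])^'] -->
    (0 : R[i]).
  apply: cvg_near_cst; near=> t; rewrite diagH ?subrr//; near: t.
    exact: nbhs_dnbhs_neq.
  apply: (@filterS _ (0 : R[i]^o)^' _ _ _ _ (dnbhs0_lt a2)) => t ta.
  (* From [|t| < 1 - |a|^2 <= 1] follows [|t|^2 <= |t| < 1 - |a|^2]. *)
  apply: (le_lt_trans _ ta); rewrite expr2 ler_piMl// ltW// (lt_le_trans ta)//.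
have : ulsubmx (H 0) 0 0 - drsubmx (H 0) 0 0 = 0 :> R[i].
  exact: (cvg_unique (@norm_hausdorff _ R[i]^o) dc d0).
rewrite H0 /dsummx block_mxKul block_mxKdr; exact: subr0_eq.
Unshelve. all: by end_near. Qed.

Lemma expc_log (a : R[i]) : `|a| < 1 -> expc (g a) = (a + 1) ^+ 4.
Proof.
move=> a1; rewrite -expmx_scalar Gexp//; last exact: row_ball_scalar.
rewrite nceval_quartic /= addr0 mulmx1 -raddfD /= -rmorphXn /= mxE.
by rewrite eqxx mulr1n.
Qed.

Lemma continuous_log (T : Type) (F : set_system T) {FF : Filter F}
    (f : T -> R[i]) (a : R[i]) : `|a| < 1 ->
  f x @[x --> F] --> a -> g (f x) @[x --> F] --> g a.
Proof.
move=> a1 fa; apply: cvg_mx_entry.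
have Gc := differentiable_continuous
  (Gan (isT : (0 < 1)%N) (row_ball_scalar a1)).
have fc : ((f x)%:M : 'M[R[i]]_1) @[x --> F] --> (a%:M : 'M[R[i]]_1).
  apply: cvg_mx => i j; rewrite !ord1 mxE eqxx mulr1n.
  by under eq_fun do rewrite mxE eqxx mulr1n.
apply: (cvg_comp (fun x => ((f x)%:M : 'M[R[i]]_1, 0 : 'M[R[i]]_1))
  (@G 1%N) _ Gc).
exact: (cvg_pair fc (cvg_cst (0 : 'M[R[i]]_1))).
Qed.

(** Factors [z^4 - 1]; the roots are written by real and imaginary parts so that [phi] can be
    computed on them. *)
Lemma unity_root4 (z : R[i]) : z ^+ 4 = 1 ->
  [\/ z = 1 +i* 0, z = (- 1) +i* 0, z = 0 +i* 1 | z = 0 +i* (- 1)].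
Proof.
move=> z4; have : (z - 1) * (z + 1) * ((z - 'i) * (z + 'i)) = 0.
  rewrite -!subr_sqr sqr_i expr1n opprK -subr_sqr expr1n.
  by rewrite -exprM z4 subrr.
move=> /eqP; rewrite !mulf_eq0 !subr_eq0 !addr_eq0.
move=> /orP[/orP[]|/orP[]] /eqP ->.
- by constructor 1.
- by constructor 2; rewrite /GRing.opp /= oppr0.
- by constructor 3.
- by constructor 4; rewrite /GRing.opp /= oppr0.
Qed.

(* 1 + p t = (1 + i t) / 2, of argument -pi/4 at t = -1 and pi/4 at t = 1. *)
Let p (t : R) : R[i] := (- 2^-1) +i* (t / 2).

(** Here [|p t|^2 = (1 + t^2) / 4], at most [1/2] on the segment. *)
Lemma path_lt1 (t : R) : -1 <= t <= 1 -> `|p t| < 1.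
Proof.
move=> /andP[t0 t1]; rewrite -(@expr_lt1 _ 2)// -add_Re2_Im2 /= ltcR.
have -> : (- 2^-1) ^+ 2 + (t / 2) ^+ 2 = (1 + t ^+ 2) / 4 :> R by field.
by rewrite ltr_pdivrMr// mul1r; nra.
Qed.

(** The quotient of two fourth roots of [(1 + p t)^4], the first supplied by the supposed
    logarithm. *)
Let u (t : R) : R[i] := expc (g (p t) / 4) / (p t + 1).
(* Re z + 2 Im z separates the four values 1, -1, i, -i, which reduces the
   constancy of u to the intermediate value theorem. *)
Let phi (t : R) : R := complex.Re (u t) + 2 * complex.Im (u t).

Lemma u_unity_root4 (t : R) : -1 <= t <= 1 -> u t ^+ 4 = 1.
Proof.
move=> /path_lt1 p1; rewrite expr_div_n -expc_mulrn.
rewrite -[g _ / 4 *+ 4]mulr_natr divfK ?pnatr_eq0//.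
by rewrite expc_log// divff// expf_neq0// unit_disc_add1_neq0.
Qed.

Lemma phi_continuous : {within `[-1, 1], continuous phi}.
Proof.
apply: continuous_in_subspaceT => t; rewrite inE /= in_itv /= => /path_lt1 pt.
have pc : p s @[s --> t] --> p t.
  apply: cvg_complex => /=; first exact: cvg_cst.
  by apply: cvgMr_tmp; exact: cvg_id.
have p1c : p s + 1 @[s --> t] --> p t + 1.
  exact: (cvgD pc (cvg_cst (1 : R[i]))).
have gc : g (p s) / 4 @[s --> t] --> g (p t) / 4.
  exact: (cvgMr_tmp (b := 4^-1 : R[i]^o) (continuous_log pt pc)).
have uc : u s @[s --> t] --> u t.
  apply: (cvgM (f := fun s => expc (g (p s) / 4)) (g := fun s => (p s + 1)^-1)).
    exact: (cvg_comp (fun s => g (p s) / 4) (@expc R) gc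
      (@expc_continuous _ _)).
  exact: (cvgV (unit_disc_add1_neq0 pt) p1c).
have [Rc Ic] := cvg_ReIm uc.
by apply: cvgD => //; apply: cvgMl_tmp.
Qed.

(** Equal values of [g] at the two ends force [u 1 = -i u(-1)], so [phi] takes distinct end values;
    but it is continuous and takes only the values 1, -1, 2, -2. *)
Lemma quartic_no_log : False.
Proof.
have pm : p (-1) + 1 = 2^-1 -i* 2^-1.
  by rewrite /p /GRing.add /=; congr (_ +i* _); field.
have pp : p 1 + 1 = 2^-1 +i* 2^-1.
  by rewrite /p /GRing.add /=; congr (_ +i* _); field.
have m1 : -1 <= (-1 : R) <= 1 by rewrite lexx/=; lra.
have p1 : -1 <= (1 : R) <= 1 by rewrite lexx; lra.
(* The ends of the path differ, after adding 1, by the fourth root of unity [-i]; hence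
   [log_eq_diag] applies to them. *)
have pmE : 2^-1 -i* 2^-1 = - 'i * (2^-1 +i* 2^-1) :> R[i].
  by apply/eqP; rewrite eq_complex /=; apply/andP; split; apply/eqP; field.
have E : g (p 1) = g (p (-1)).
  apply: log_eq_diag; rewrite ?path_lt1// pm pp.
  have i4 : (- 'i) ^+ 4 = 1 :> R[i].
    by rewrite (exprM _ 2 2) sqrrN sqr_i sqrrN expr1n.
  by rewrite pmE exprMn i4 mul1r.
have i0 : - 'i != 0 :> R[i] by rewrite eq_complex /= !oppr_eq0 oner_eq0 andbF.
have uE : u 1 = - 'i * u (-1).
  rewrite /u E pm pp mulrCA; congr (_ * _).
  by rewrite pmE invfM mulrA divff// mul1r.
have ivt v : Num.min (phi (-1)) (phi 1) <= v <= Num.max (phi (-1)) (phi 1) ->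
    [\/ v = 1, v = -1, v = 2 | v = -2].
  move=> /(IVT (_ : -1 <= 1) phi_continuous)[|t]; first by lra.
  rewrite in_itv /= => /u_unity_root4/unity_root4 ut <-; rewrite /phi.
  case: ut => -> /=; rewrite ?mulr0 ?mulr1 ?addr0 ?add0r.
  - by constructor 1.
  - by constructor 2.
  - by constructor 3.
  - by constructor 4; rewrite mulrN1.
have := u_unity_root4 m1 => /unity_root4 um.
(* As [u (-1)] is 1, -1, i or -i, [phi] goes from 1 to -2, -1 to 2, 2 to 1 or -2 to -1; [v] is an
   intermediate value outside the four allowed ones. *)
have {um} : exists2 v : R,
   Num.min (phi (-1)) (phi 1) <= v <= Num.max (phi (-1)) (phi 1) &
   [\/ v = 0, v = 3/2 | v = -3/2].
  rewrite /phi uE; case: um => -> /=.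
  - exists 0; last by constructor 1.
    rewrite ge_min le_max; lra.
  - exists 0; last by constructor 1.
    rewrite ge_min le_max; lra.
  - exists (3/2); last by constructor 2.
    rewrite ge_min le_max; lra.
  - exists (-3/2); last by constructor 3.
    rewrite ge_min le_max; lra.
move=> [v /ivt vv]; clear pm pp pmE E i0 uE ivt.
by case: vv => ->; case => h; lra.
Qed.

End NoLog.

Theorem mainTheorem6 (R : realType) :
  exists c : ncseries R,
    in_fock c /\
    (forall (n : nat) (p : mxpair R n),
       (0 < n)%N -> row_ball p -> nceval c p \in unitmx) /\
    ~ has_log c.
Proof.
exists (quartic_coef R); split; first exact: in_fock_quartic.
split=> [n p _ /row_ball_add1_unit[X1 Y1]|[G [Gfree [Gan Gexp]]]].
  set x := p.1 + 1%:M in X1.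
  rewrite nceval_quartic -[_ ^+ 4]/(x *m (x *m (x *m x))).
  by rewrite !unitmx_mul X1 Y1.
exact: quartic_no_log Gfree Gan Gexp.
Qed.
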